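(* Let $\Omega$ be a locally compact space. For a Banach module $\Gamma$ over $\mathrm{C}_0(\Omega)$ the following are equivalent. (a) $\Gamma$ is an AL-module over $\mathrm{C}_0(\Omega)$. (b) $\Gamma$ admits a $\mathrm{C}_0(\Omega)'$-valued norm. If these assertions hold, then the $\mathrm{C}_0(\Omega)'$-valued norm is unique and given by $|s|(f)=\|fs\|$ for all $s\in\Gamma$ and $f\in\mathrm{C}_0(\Omega)_+$.
   Context: All vector spaces are over a fixed field $\mathbb{K}\in\{\mathbb{R},\mathbb{C}\}$; locally compact spaces are Hausdorff; $\mathrm{C}_0(\Omega)$ is the algebra of continuous $\mathbb{K}$-valued functions vanishing at infinity, $\mathrm{C}_0(\Omega)_+$ its non-negative elements. A Banach module over $\mathrm{C}_0(\Omega)$ is a Banach space $\Gamma$ which is a $\mathrm{C}_0(\Omega)$-module with $\|fs\|\le\|f\|\|s\|$; always assumed non-degenerate, i.e. $\Gamma=\overline{\mathrm{lin}}\{fs:f\in\mathrm{C}_0(\Omega),s\in\Gamma\}$. It is an AL-module if for each $s\in\Gamma$ the submodule $\Gamma_s=\overline{\mathrm{C}_0(\Omega)s}$, which is a Banach lattice with positive cone $\overline{\mathrm{C}_0(\Omega)_+s}$, is an AL-space; equivalently $\|f_1s+f_2s\|=\|f_1s\|+\|f_2s\|$ for all $f_1,f_2\in\mathrm{C}_0(\Omega)_+$ and $s\in\Gamma$. $\mathrm{C}_0(\Omega)'$ is the dual Banach lattice, $\mathrm{C}_0(\Omega)'_+$ its cone of positive functionals, with $(f\cdot\mu)(g)=\mu(fg)$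 for $f,g\in\mathrm{C}_0(\Omega)$, $\mu\in\mathrm{C}_0(\Omega)'$. A $\mathrm{C}_0(\Omega)'$-valued norm on $\Gamma$ is a map $|\cdot|\colon\Gamma\to\mathrm{C}_0(\Omega)'_+$ with (i) $\||s|\|=\|s\|$, (ii) $|fs|=|f|\cdot|s|$, (iii) $|s_1+s_2|\le|s_1|+|s_2|$ for all $s,s_1,s_2\in\Gamma$ and $f\in\mathrm{C}_0(\Omega)$. *)

(* Defs.v *)
From HB Require Import structures.
From mathcomp Require Import all_boot all_order all_algebra.
From mathcomp Require Import all_classical all_reals all_analysis.
From mathcomp.real_closed Require Import complex.

Set Implicit Arguments.
Unset Strict Implicit.
Unset Printing Implicit Defensive.

Import Order.TTheory GRing.Theory Num.Theory.
Import numFieldNormedType.Exports.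
Local Open Scope classical_set_scope.
Local Open Scope ring_scope.

Variant scalar_kind := RealScalars | ComplexScalars.

(* The base field, R or C.  As usual for numFieldTypes, norms of vectors are
   nonnegative elements of the field itself, and [0 <= z] in C means that z is
   real and nonnegative. *)
Definition scalars (R : realType) (k : scalar_kind) : numFieldType :=
  match k with RealScalars => (R : numFieldType)
             | ComplexScalars => (R[i] : numFieldType) end.

(* Bounded nonempty sets of nonnegative scalars have suprema, so [supremum 0]
   computes both the sup norm of C0 and the operator norm of its dual. *)
Lemma scalars_supremumP (R : realType) (k : scalar_kind)
    (A : set (scalars R k)) (M : scalars R k) :
  A !=set0 -> (forall x, A x -> 0 <= x) -> ubound A M ->
  supremums A (supremum 0 A).
Proof.
move=> A0 Age0 AM; rewrite /supremum; case: ifPn => [/eqP A00|_].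
  by move/set0P: A0; rewrite A00 eqxx.
suff [s As] : supremums A !=set0 by apply: xgetPex; exists s.
case: k A M A0 Age0 AM => /= A M A0 Age0 AM.
  have hs : has_sup A by split => //; exists M.
  exists (sup A : R); split; first by move=> x Ax; apply: sup_upper_bound.
  by move=> y Ay; apply: ge_sup.
have ReA x : A x -> x = (complex.Re x)%:C%C.
  by move=> /Age0; case: x => a b; rewrite lecE /= => /andP[/eqP -> _].
pose B : set R := [set complex.Re x | x in A].
have hs : has_sup B.
  split; first by case: A0 => x Ax; exists (complex.Re x), x.
  exists (complex.Re M) => _ [x Ax <-].
  by have := AM _ Ax; rewrite lecE => /andP[].
exists (sup B)%:C%C; split.
  move=> x Ax; rewrite (ReA _ Ax) lecR.
  by apply: sup_upper_bound => //; exists x.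
move=> y Ay; rewrite lecE /=; apply/andP; split.
  case: A0 => x Ax; have := Ay _ Ax; rewrite (ReA _ Ax) lecE /=.
  by case/andP.
apply: ge_sup; first by case: hs.
by move=> _ [x Ax <-]; have := Ay _ Ax; rewrite lecE => /andP[].
Qed.

Section sup_of_norms.
Variables (R : realType) (k : scalar_kind).
Local Notation K := (scalars R k).

(* This is 0 if B is empty. *)
Definition norm_sup (T : Type) (B : set T) (F : T -> K^o) : K :=
  supremum 0 [set `|F t| | t in B].

Definition bounded_over (T : Type) (B : set T) (F : T -> K^o) :=
  exists M : K, forall t, B t -> `|F t| <= M.

Variables (T : Type) (B : set T).
Implicit Types F G : T -> K^o.

Lemma norm_supP F : bounded_over B F -> B !=set0 ->
  supremums [set `|F t| | t in B] (norm_sup B F).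
Proof.
move=> [M FM] [t Bt]; apply: (@scalars_supremumP _ _ _ M).
- by exists `|F t|, t.
- by move=> _ [u _ <-].
- by move=> _ [u Bu <-]; exact: FM.
Qed.

Lemma norm_sup_ge F t : bounded_over B F -> B t -> `|F t| <= norm_sup B F.
Proof.
by move=> bF Bt; have [+ _] := norm_supP bF (ex_intro _ t Bt); apply; exists t.
Qed.

Lemma norm_sup_le F M : 0 <= M -> (forall t, B t -> `|F t| <= M) ->
  norm_sup B F <= M.
Proof.
move=> M0 FM; have [->|/set0P B0] := eqVneq B set0.
  by rewrite /norm_sup image_set0 /supremum eqxx.
have [|_] := norm_supP _ B0 (F := F); first by exists M.
by apply=> _ [t Bt <-]; exact: FM.
Qed.

Lemma norm_sup_ge0 F : bounded_over B F -> 0 <= norm_sup B F.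
Proof.
move=> bF; have [->|/set0P[t Bt]] := eqVneq B set0.
  by rewrite /norm_sup image_set0 /supremum eqxx.
exact: le_trans (normr_ge0 _) (norm_sup_ge bF Bt).
Qed.

Lemma norm_supD F G : bounded_over B F -> bounded_over B G ->
  norm_sup B (F + G) <= norm_sup B F + norm_sup B G.
Proof.
move=> bF bG; apply: norm_sup_le => [|t Bt].
  by rewrite addr_ge0// norm_sup_ge0.
by rewrite (le_trans (ler_normD _ _))// lerD// norm_sup_ge.
Qed.

Lemma norm_supZ a F : bounded_over B F ->
  norm_sup B (a *: F) = `|a| * norm_sup B F.
Proof.
move=> bF; apply/eqP; rewrite eq_le; apply/andP; split.
  apply: norm_sup_le => [|t Bt]; first by rewrite mulr_ge0// norm_sup_ge0.
  by rewrite normrZ ler_wpM2l// norm_sup_ge.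
have bZ : bounded_over B (a *: F).
  have [M FM] := bF; exists (`|a| * M) => t Bt.
  by rewrite normrZ ler_wpM2l// FM.
have [->|a0] := eqVneq a 0.
  by rewrite normr0 mul0r scale0r norm_sup_ge0//; exists 0 => t _; rewrite normr0.
rewrite mulrC -ler_pdivlMr ?normr_gt0//.
apply: norm_sup_le => [|t Bt]; first by rewrite divr_ge0// norm_sup_ge0.
rewrite ler_pdivlMr ?normr_gt0// mulrC -normrZ.
exact: (@norm_sup_ge (a *: F)).
Qed.

End sup_of_norms.

Section C0.
Variables (R : realType) (k : scalar_kind) (Omega : topologicalType).
Local Notation K := (scalars R k).

Definition vanishes_at_infinity (f : Omega -> K^o) :=
  forall e : K, 0 < e -> exists2 A : set Omega,
    compact A & forall x, ~ A x -> `|f x| < e.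

Definition is_C0 : {pred Omega -> K^o} :=
  [pred f | `[< continuous f /\ vanishes_at_infinity f >]].

Lemma is_C0_submod : submod_closed is_C0.
Proof.
split=> [|a f g /asboolP[cf vf] /asboolP[cg vg]]; apply/asboolP; split.
- exact: cst_continuous.
- by move=> e e0; exists set0 => [|x _]; [exact: compact0|rewrite normr0].
- by move=> x; apply: cvgD; [apply: cvgZl_tmp; exact: cf|exact: cg].
- move=> e e0.
  have a0 : 0 < `|a| + 1 by rewrite ltr_wpDl.
  have [A cA fA] := vf (e / 2 / (`|a| + 1)) (divr_gt0 (divr_gt0 e0 (ltr0Sn _ _)) a0).
  have [B cB gB] := vg (e / 2) (divr_gt0 e0 (ltr0Sn _ _)).
  exists (A `|` B); first exact: compactU.
  move=> x /not_orP[/fA fx /gB gx].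
  apply: (le_lt_trans (ler_normD _ _)); rewrite [ltRHS]splitr.
  apply: ler_ltD => //; rewrite normrZ.
  apply: (@le_trans _ _ ((`|a| + 1) * `|f x|)).
    by rewrite ler_wpM2r// lerDl.
  by rewrite mulrC -ler_pdivlMr// ltW.
Qed.

HB.instance Definition _ := GRing.isSubmodClosed.Build K (Omega -> K^o) is_C0
  is_C0_submod.

Record C0 := MkC0 { C0_fun :> Omega -> K^o ; _ : C0_fun \in is_C0 }.

HB.instance Definition _ := [isSub for C0_fun].
HB.instance Definition _ := [Choice of C0 by <:].
HB.instance Definition _ := [SubChoice_isSubLmodule of C0 by <:].

Lemma C0_continuous (f : C0) : continuous f.
Proof. by have /asboolP[] := valP f. Qed.

Lemma C0_vanishes (f : C0) : vanishes_at_infinity f.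
Proof. by have /asboolP[] := valP f. Qed.

Lemma C0_bounded (f : C0) : bounded_over setT f.
Proof.
have [A cA fA] := C0_vanishes f (@ltr01 K).
have : \forall M \near (+oo : set_system K), A `<=` [set x | `|f x| <= M].
  apply: ((compact_near_coveringP A).1 cA K (+oo : set_system K)
    (fun M x => `|f x| <= M)) => x Ax.
  exists ([set y | `|f y - f x| <= 1], [set M | `|f x| + 1 <= M]) => /=.
    split; last by apply: nbhs_pinfty_ge; rewrite ger0_real ?addr_ge0.
    by have /cvgrPdistC_le := @C0_continuous f x; apply.
  move=> [y M] /= [fy]; apply: le_trans.
  by rewrite -lerBlDl (le_trans (lerB_dist _ _)).
move=> /pinfty_ex_gt0[M M0 AM]; exists (M + 1) => x _.
have [Ax|nAx] := pselect (A x).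
  by rewrite (le_trans (AM _ Ax))// lerDl.
by rewrite (le_trans (ltW (fA _ nAx)))// lerDr ltW.
Qed.

Definition C0_norm (f : C0) : K := norm_sup setT f.

Lemma C0_normD f g : C0_norm (f + g) <= C0_norm f + C0_norm g.
Proof. by apply: norm_supD; exact: C0_bounded. Qed.

Lemma C0_normZ (a : K) f : C0_norm (a *: f) = `|a| * C0_norm f.
Proof. by apply: norm_supZ; exact: C0_bounded. Qed.

Lemma C0_norm0_eq0 f : C0_norm f = 0 -> f = 0.
Proof.
move=> f0; apply: val_inj; apply/funext => x.
apply/eqP; rewrite -normr_le0 -[leRHS]f0.
by apply: norm_sup_ge => //; exact: C0_bounded.
Qed.

HB.instance Definition _ := Lmodule_isNormed.Build K C0
  C0_normD C0_normZ C0_norm0_eq0.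

Lemma C0_norm_ge (f : C0) x : `|f x| <= `|f|.
Proof. by apply: norm_sup_ge => //; exact: C0_bounded. Qed.

Lemma C0_norm_le (f : C0) (M : K) :
  0 <= M -> (forall x, `|f x| <= M) -> `|f| <= M.
Proof. by move=> M0 fM; apply: norm_sup_le. Qed.

Lemma C0_mul_subproof (f g : C0) : (fun x => f x * g x : K^o) \in is_C0.
Proof.
apply/asboolP; split.
  by move=> x; apply: (@cvgM K); exact: C0_continuous.
move=> e e0.
have [M gM] := C0_bounded g.
have M0 : 0 < `|M| + 1 by rewrite ltr_wpDl.
have [A cA fA] := C0_vanishes f (divr_gt0 e0 M0).
exists A => // x nAx; rewrite normrM.
have gM1 : `|g x| <= `|M| + 1.
  rewrite (le_trans (gM x I))// (@le_trans _ _ `|M|) ?lerDl//.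
  by rewrite ger0_norm// (le_trans _ (gM x I)).
rewrite (@le_lt_trans _ _ (`|f x| * (`|M| + 1))) ?ler_wpM2l//.
by rewrite -ltr_pdivlMr// fA.
Qed.

Definition C0_mul (f g : C0) : C0 := MkC0 (C0_mul_subproof f g).

Lemma C0_mul_linear f : linear (C0_mul f).
Proof.
move=> a g h; apply: val_inj; apply/funext => x.
change (f x * (a * g x + h x) = a * (f x * g x) + f x * h x).
by rewrite mulrDr mulrCA.
Qed.

Lemma C0_mul_continuous f : continuous (C0_mul f).
Proof.
pose L := GRing.isLinear.Build K C0 C0 *:%R (C0_mul f) (C0_mul_linear f).
pose l : {linear C0 -> C0} := HB.pack (C0_mul f) L.
apply: (@bounded_linear_continuous _ _ _ l); apply/bounded_funP => r.
exists (`|f| * `|r|) => g gr; apply: C0_norm_le => [|x].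
  by rewrite mulr_ge0.
rewrite normrM ler_pM ?C0_norm_ge// (le_trans (C0_norm_ge g x))//.
by rewrite (le_trans gr)// ger0_norm// (le_trans _ gr).
Qed.

Lemma C0_abs_subproof (f : C0) : (fun x => `|f x| : K^o) \in is_C0.
Proof.
apply/asboolP; split.
  by move=> x; apply: cvg_norm; exact: C0_continuous.
move=> e e0; have [A cA fA] := C0_vanishes f e0.
by exists A => // x nAx; rewrite normr_id fA.
Qed.

Definition C0_abs (f : C0) : C0 := MkC0 (C0_abs_subproof f).

Definition C0_pos : set C0 := [set f | forall x, 0 <= (f x : K)].

End C0.

Section dual.
Variables (R : realType) (k : scalar_kind) (V : normedModType (scalars R k)).
Local Notation K := (scalars R k).

Definition is_dual : {pred V -> K^o} :=
  [pred mu | `[< linear mu /\ continuous mu >]].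

Lemma is_dual_submod : submod_closed is_dual.
Proof.
split=> [|a mu nu /asboolP[lm cm] /asboolP[ln cn]]; apply/asboolP; split.
- by move=> b x y /=; rewrite scaler0 addr0.
- exact: cst_continuous.
- move=> b x y; rewrite !fctE lm ln !scalerDr !scalerA [a * b]mulrC.
  by rewrite addrACA.
- by move=> x; apply: cvgD; [apply: cvgZl_tmp; exact: cm|exact: cn].
Qed.

HB.instance Definition _ := GRing.isSubmodClosed.Build K (V -> K^o) is_dual
  is_dual_submod.

Record dual := MkDual { dual_fun :> V -> K^o ; _ : dual_fun \in is_dual }.

HB.instance Definition _ := [isSub for dual_fun].
HB.instance Definition _ := [Choice of dual by <:].
HB.instance Definition _ := [SubChoice_isSubLmodule of dual by <:].

Lemma dual_linear (mu : dual) : linear mu.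
Proof. by have /asboolP[] := valP mu. Qed.

Lemma dual_continuous (mu : dual) : continuous mu.
Proof. by have /asboolP[] := valP mu. Qed.

Lemma dual_bounded (mu : dual) : bounded_over [set v | `|v| <= 1] mu.
Proof.
pose L := GRing.isLinear.Build K V K^o *:%R mu (@dual_linear mu).
pose l : {linear V -> K^o} := HB.pack (mu : V -> K^o) L.
have /linear_bounded_continuous/bounded_funP/(_ 1)[M lM] : continuous l.
  exact: dual_continuous.
by exists M => v; exact: lM.
Qed.

Definition dual_norm (mu : dual) : K := norm_sup [set v | `|v| <= 1] mu.

Lemma dual_normD mu nu : dual_norm (mu + nu) <= dual_norm mu + dual_norm nu.
Proof. by apply: norm_supD; exact: dual_bounded. Qed.

Lemma dual_normZ (a : K) mu : dual_norm (a *: mu) = `|a| * dual_norm mu.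
Proof. by apply: norm_supZ; exact: dual_bounded. Qed.

Lemma dual_norm0_eq0 mu : dual_norm mu = 0 -> mu = 0.
Proof.
move=> mu0; apply: val_inj; apply/funext => v.
have muZ a u : mu (a *: u) = a *: mu u.
  have l0 : mu 0 = 0.
    have := dual_linear mu 1 0 0; rewrite !scale1r addr0 => /eqP.
    by rewrite -subr_eq0 opprD addrA subrr sub0r oppr_eq0 => /eqP.
  by have := dual_linear mu a u 0; rewrite !addr0 l0 addr0.
change (mu v = 0).
have [->|v0] := eqVneq v 0; first by have := muZ 0 0; rewrite !scale0r.
have nv : `|v| != 0 by rewrite normr_eq0.
have -> : mu v = `|v| *: mu (`|v|^-1 *: v).
  by rewrite -muZ scalerA mulfV// scale1r.
suff -> : mu (`|v|^-1 *: v) = 0 by rewrite scaler0.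
apply/eqP; rewrite -normr_le0 -[leRHS]mu0.
apply: norm_sup_ge; first exact: dual_bounded.
by rewrite /= normrZ ger0_norm ?invr_ge0// mulVf.
Qed.

HB.instance Definition _ := Lmodule_isNormed.Build K dual
  dual_normD dual_normZ dual_norm0_eq0.

End dual.

Section C0_dual.
Variables (R : realType) (k : scalar_kind) (Omega : topologicalType).
Local Notation K := (scalars R k).
Local Notation C0 := (C0 R k Omega).

Definition dual_pos : set (dual C0) :=
  [set mu | forall f, C0_pos f -> 0 <= (mu f : K)].

Definition dual_le (mu nu : dual C0) := dual_pos (nu - mu).

Lemma C0_actd_subproof (f : C0) (mu : dual C0) :
  (fun g => mu (C0_mul f g)) \in is_dual (V := C0).
Proof.
apply/asboolP; split.
  by move=> a g h; rewrite C0_mul_linear dual_linear.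
move=> g; apply: continuous_comp; first exact: C0_mul_continuous.
exact: dual_continuous.
Qed.

Definition C0_actd (f : C0) (mu : dual C0) : dual C0 :=
  MkDual (C0_actd_subproof f mu).

End C0_dual.

Section modules.
Variables (R : realType) (k : scalar_kind) (Omega : topologicalType).
Variable (Gamma : completeNormedModType (scalars R k)).
Local Notation K := (scalars R k).
Local Notation C0 := (C0 R k Omega).
Implicit Types (act : C0 -> Gamma -> Gamma) (s : Gamma) (f g : C0).

Definition lin (A : set Gamma) : set Gamma :=
  [set v | exists n (a : 'I_n -> K) (u : 'I_n -> Gamma),
     (forall i, A (u i)) /\ v = \sum_(i < n) a i *: u i].

Record banach_module act : Prop := BanachModule {
  act_linearl : forall s, linear (act^~ s) ;
  act_linearr : forall f, linear (act f) ;
  actM : forall f g s, act (C0_mul f g) s = act f (act g s) ;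
  act_norm : forall f s, `|act f s| <= `|f| * `|s| ;
  act_nondegenerate :
    closure (lin [set act f s | f in [set: C0] & s in [set: Gamma]]) = setT
}.

Definition cyclic_cone act s : set Gamma :=
  closure [set act f s | f in @C0_pos R k Omega].

(* For every s, the closure of [C0 s], with positive cone [cyclic_cone act s],
   is a Banach lattice; it is thus an AL-space iff its norm is additive on that
   cone. *)
Definition AL_module act := forall s u v,
  cyclic_cone act s u -> cyclic_cone act s v -> `|u + v| = `|u| + `|v|.

Record dual_valued_norm act (N : Gamma -> dual C0) : Prop := DualValuedNorm {
  dvn_pos : forall s, dual_pos (N s) ;
  dvn_norm : forall s, `|N s| = `|s| ;
  dvn_act : forall f s, N (act f s) = C0_actd (C0_abs f) (N s) ;
  dvn_triangle : forall s1 s2, dual_le (N (s1 + s2)) (N s1 + N s2)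
}.

End modules.

(* Main.v *)
From HB Require Import structures.
Require Import Defs.
From mathcomp Require Import all_boot all_order all_algebra.
From mathcomp Require Import all_classical all_reals all_analysis.
From mathcomp Require Import ring.
From mathcomp.real_closed Require Import complex.

(** The heart of the matter is that a dual-valued norm is forced: on
    non-negative f it has to be |s|(f) = ||f s||, and this formula extends to
    a functional exactly when f |-> ||f s|| is additive on the cone of
    non-negative functions, which is what an AL-module is.

    The formula is forced because ||f s|| = || |f s| || = || f . |s| ||, and
    ||f . mu|| = mu(f) whenever f and mu are non-negative
    ([dual_pos_norm_actd]).  A functional is determined by its values on
    non-negative functions ([dual_pos_ext]), hence uniqueness.  From a
    dual-valued norm one gets additivity of f |-> ||f s|| because the norm of
    the dual is additive on positive functionals ([dual_pos_normD]); continuity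
    of the norm carries this to the closed cones.

    Conversely, in an AL-module f |-> ||f s|| is additive and positively
    homogeneous on the non-negative functions, so it extends to a positive
    functional |s| on all of C0 ([cone_extension]).  The axioms of a
    dual-valued norm then say that
    - ||s|| is the supremum of ||u s|| over the unit ball of C0: this is where
      non-degeneracy enters ([act_approx_unit]);
    - ||g f s|| = || g |f| s|| : in every Banach module the norm of f s depends
      only on |f|, and monotonically ([act_norm_mono]);
    - ||f (s + t)|| <= ||f s|| + ||f t||, which is clear.

    Both of the first two rest on one construction.  For eta > 0 the function
    u = |g|^2 / (|g|^2 + eta^2) lies in the unit ball of C0, and u f is within
    eta of f as soon as |f| <= |g|; moreover u f = w g where
    w = f conj(g) / (|g|^2 + eta^2) also lies in the unit ball.  So u is an
    approximate unit, and w shows that every f dominated by g is nearly a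
    contractive multiple of g ([C0_damp_near], [C0_damp_mul]).

    Real and complex scalars are treated together: real part, imaginary part
    and imaginary unit are defined for both fields, with the imaginary unit
    equal to 0 in the real case. *)

Set Implicit Arguments.
Unset Strict Implicit.
Unset Printing Implicit Defensive.

Import Order.TTheory GRing.Theory Num.Theory.
Import numFieldNormedType.Exports.
Local Open Scope classical_set_scope.
Local Open Scope ring_scope.

(** * Real and imaginary parts over both scalar fields *)

Section scalars.
Variables (R : realType) (k : scalar_kind).
Local Notation K := (scalars R k).
Implicit Types a b : K.

(** In the real case the imaginary part and the imaginary unit are both 0; the
    identities below are those that hold in this degenerate case as well, so
    that it never has to be distinguished again. *)
Definition scalar_re : K -> K :=
  match k return scalars R k -> scalars R k with
  | RealScalars => id
  | ComplexScalars => fun z : R[i] => 'Re z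
  end.

Definition scalar_im : K -> K :=
  match k return scalars R k -> scalars R k with
  | RealScalars => fun=> 0
  | ComplexScalars => fun z : R[i] => 'Im z
  end.

Definition scalar_i : K :=
  match k return scalars R k with
  | RealScalars => 0
  | ComplexScalars => ('i : R[i])
  end.

Lemma scalar_rect a : scalar_re a + scalar_i * scalar_im a = a.
Proof.
rewrite /scalar_re /scalar_im /scalar_i; case: k a => a /=;
  first by rewrite mul0r addr0.
by rewrite -Crect.
Qed.

Lemma scalar_reD a b : scalar_re (a + b) = scalar_re a + scalar_re b.
Proof. by rewrite /scalar_re; case: k a b => //= a b; rewrite raddfD. Qed.

Lemma scalar_imD a b : scalar_im (a + b) = scalar_im a + scalar_im b.
Proof.
by rewrite /scalar_im; case: k a b => //= a b; rewrite ?addr0// raddfD.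
Qed.

Lemma scalar_reM a b :
  scalar_re (a * b) = scalar_re a * scalar_re b - scalar_im a * scalar_im b.
Proof.
rewrite /scalar_re /scalar_im; case: k a b => /= a b;
  first by rewrite mulr0 subr0.
by rewrite ReM.
Qed.

Lemma scalar_imM a b :
  scalar_im (a * b) = scalar_re a * scalar_im b + scalar_im a * scalar_re b.
Proof.
rewrite /scalar_re /scalar_im; case: k a b => /= a b;
  first by rewrite mulr0 mul0r addr0.
by rewrite ImM ['Im a * _]mulrC.
Qed.

(** The square of the imaginary unit is -1 only on imaginary parts, which
    vanish in the real case. *)
Lemma scalar_iiM a : scalar_i * (scalar_i * scalar_im a) = - scalar_im a.
Proof.
rewrite /scalar_i /scalar_im; case: k a => /= a; first by rewrite !mulr0 oppr0.
by rewrite mulrA -expr2 sqrCi mulN1r.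
Qed.

Lemma scalar_re_i : scalar_re scalar_i = 0.
Proof. by rewrite /scalar_re /scalar_i; case: k => //=; exact: Re_i. Qed.

Lemma scalar_re_real a : scalar_re a \is Num.real.
Proof.
by rewrite /scalar_re; case: k a => /= a; [exact: num_real|exact: Creal_Re].
Qed.

Lemma scalar_im_real a : scalar_im a \is Num.real.
Proof.
by rewrite /scalar_im; case: k a => /= a; [exact: real0|exact: Creal_Im].
Qed.

Lemma real_scalar_re a : a \is Num.real -> scalar_re a = a.
Proof. by rewrite /scalar_re; case: k a => //= a /Creal_ReP. Qed.

Lemma real_scalar_im a : a \is Num.real -> scalar_im a = 0.
Proof. by rewrite /scalar_im; case: k a => //= a /Creal_ImP. Qed.

Definition scalar_conj a : K := scalar_re a - scalar_i * scalar_im a.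

Lemma scalar_conjM a : scalar_conj a * a = `|a| ^+ 2.
Proof.
rewrite /scalar_conj /scalar_re /scalar_i /scalar_im; case: k a => /= a.
  by rewrite mul0r subr0 real_normK// num_real.
have <- : a^* = 'Re a - 'i * 'Im a.
  by rewrite {1}(Crect a) conjC_rect ?Creal_Re ?Creal_Im.
by rewrite normCK mulrC.
Qed.

Lemma norm_scalar_re a : `|scalar_re a| <= `|a|.
Proof.
by rewrite /scalar_re; case: k a => //= a; have [] := leif_normC_Re_Creal a.
Qed.

Lemma norm_scalar_im a : `|scalar_im a| <= `|a|.
Proof.
rewrite /scalar_im; case: k a => /= a; first by rewrite normr0.
by have [] := leif_normC_Re_Creal ('i * a);
  rewrite ReMil normrN normrM normCi mul1r.
Qed.

Lemma ler_add_eps_mul a b c : 0 <= c ->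
  (forall e : K, 0 < e -> a <= b + e * c) -> a <= b.
Proof.
move=> c0 ab; apply/ler_addgt0Pr => e e0.
have c1 : 0 < c + 1 by rewrite ltr_wpDl.
apply: le_trans (ab _ (divr_gt0 e0 c1)) _.
by rewrite lerD2l mulrAC ler_pdivrMr// ler_wpM2l ?ltW// ltrDl.
Qed.

Lemma norm_scalar_conj a : `|scalar_conj a| = `|a|.
Proof.
have [->|a0] := eqVneq a 0.
  rewrite /scalar_conj !(real_scalar_re (real0 _)).
  by rewrite !(real_scalar_im (real0 _)) mulr0 subr0.
apply: (mulIf (x := `|a|)); first by rewrite normr_eq0.
by rewrite -normrM scalar_conjM ger0_norm ?exprn_ge0// expr2.
Qed.

End scalars.

(** * Functions vanishing at infinity *)

Section C0_theory.
Variables (R : realType) (k : scalar_kind) (Omega : topologicalType).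
Local Notation K := (scalars R k).
Local Notation C0 := (C0 R k Omega).
Implicit Types (f g h : C0) (x : Omega).

Lemma C0_ext f g : (forall x, f x = g x) -> f = g.
Proof. by move=> fg; apply: val_inj; apply/funext. Qed.

Lemma C0_0E x : (0 : C0) x = 0. Proof. by []. Qed.
Lemma C0_addE f g x : (f + g) x = f x + g x. Proof. by []. Qed.
Lemma C0_oppE f x : (- f) x = - f x. Proof. by []. Qed.
Lemma C0_scaleE (a : K) f x : (a *: f) x = (a * (f x : K) : K).
Proof. by []. Qed.
Lemma C0_mulE f g x : C0_mul f g x = (f x : K) * g x. Proof. by []. Qed.
Lemma C0_absE f x : C0_abs f x = `|f x|. Proof. by []. Qed.

Lemma C0_sumE (I : finType) (F : I -> C0) x :
  (\sum_i F i) x = \sum_i (F i x : K).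
Proof. by apply: (big_morph (fun f : C0 => f x : K)). Qed.

Lemma is_C0_dominated (g : Omega -> K^o) f (c : K) : 0 < c ->
  continuous g -> (forall x, `|g x| <= c * `|f x|) -> g \in @is_C0 R k Omega.
Proof.
move=> c0 cg gf; apply/asboolP; split=> // e e0.
have [A cA fA] := C0_vanishes f (divr_gt0 e0 c0).
exists A => // x nAx; apply: le_lt_trans (gf x) _.
by rewrite mulrC -ltr_pdivlMr// fA.
Qed.

Lemma contraction_comp_continuous (phi : K -> K) f :
  (forall a b, phi (a + b) = phi a + phi b) -> (forall a, `|phi a| <= `|a|) ->
  continuous ((fun x => phi (f x)) : Omega -> K^o).
Proof.
move=> phiD phi1 x; apply/cvgrPdist_le => e e0.
have phiN a : phi (- a) = - phi a.
  have phi0 : phi 0 = 0.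
    by apply/eqP; rewrite -normr_le0 -[leRHS](@normr0 K K).
  by apply/eqP; rewrite -subr_eq0 opprK -phiD addNr phi0.
have /cvgrPdist_le/(_ e e0) := @C0_continuous _ _ _ f x.
apply: filterS => y; apply: le_trans.
by rewrite -[X in `|_ + X|]phiN -phiD.
Qed.

Lemma contraction_comp_C0 (phi : K -> K) f :
  (forall a b, phi (a + b) = phi a + phi b) -> (forall a, `|phi a| <= `|a|) ->
  ((fun x => phi (f x)) : Omega -> K^o) \in @is_C0 R k Omega.
Proof.
move=> phiD phi1; apply: (@is_C0_dominated _ f 1) => // [|x].
  exact: contraction_comp_continuous.
by rewrite mul1r.
Qed.

Definition C0_re f : C0 :=
  MkC0 (contraction_comp_C0 f (@scalar_reD R k) (@norm_scalar_re R k)).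

Definition C0_im f : C0 :=
  MkC0 (contraction_comp_C0 f (@scalar_imD R k) (@norm_scalar_im R k)).

Lemma C0_reE f x : C0_re f x = scalar_re (f x). Proof. by []. Qed.
Lemma C0_imE f x : C0_im f x = scalar_im (f x). Proof. by []. Qed.

Definition C0_conj f : C0 := C0_re f - scalar_i R k *: C0_im f.

Lemma C0_conjE f x : C0_conj f x = scalar_conj (f x). Proof. by []. Qed.

Definition C0_simpl := (C0_0E, C0_addE, C0_oppE, C0_scaleE, C0_mulE, C0_absE,
  C0_reE, C0_imE, C0_conjE).

Lemma C0_reIm f : C0_re f + scalar_i R k *: C0_im f = f.
Proof. by apply: C0_ext => x; rewrite !C0_simpl; exact: scalar_rect. Qed.

(** The function f conj(g) / (|g|^2 + eta^2) imitates f / g without dividing by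
    zero.  For f = g it is an approximate unit for all functions dominated by
    g. *)
Section damp.
Variables (g : C0) (eta : K) (eta0 : 0 < eta).

Let den x : K := `|g x : K| ^+ 2 + eta ^+ 2.

Let den_gt0 x : 0 < den x.
Proof. by rewrite ltr_wpDl ?exprn_ge0 ?exprn_gt0. Qed.

Lemma C0_damp_subproof f :
  (fun x => f x * scalar_conj (g x) / den x : K^o) \in @is_C0 R k Omega.
Proof.
apply: (@is_C0_dominated _ (C0_mul f (C0_conj g)) (eta ^- 2)) => [||x].
- by rewrite invr_gt0 exprn_gt0.
- move=> x; apply: (@cvgM K).
    exact: (@C0_continuous _ _ _ (C0_mul f (C0_conj g))).
  apply: (@cvgV K); first by rewrite gt_eqF.
  apply: (@cvgD K); last exact: cvg_cst.
  have ca := @C0_continuous _ _ _ (C0_abs g).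
  by apply: (@cvgM K); exact: ca.
- rewrite normrM [leRHS]mulrC ler_wpM2l//.
  rewrite normfV (ger0_norm (ltW (den_gt0 x))) lef_pV2 ?posrE ?exprn_gt0//.
  by rewrite lerDr exprn_ge0.
Qed.

Definition C0_damp f : C0 := MkC0 (C0_damp_subproof f).

Lemma C0_dampE f x : C0_damp f x = (f x : K) * scalar_conj (g x) / den x.
Proof. by []. Qed.

Lemma C0_damp_le1 f : (forall x, `|f x : K| <= `|g x : K|) -> `|C0_damp f| <= 1.
Proof.
move=> fg; apply: C0_norm_le => // x.
rewrite C0_dampE !normrM norm_scalar_conj normfV (ger0_norm (ltW (den_gt0 x))).
rewrite ler_pdivrMr// mul1r /den expr2.
by rewrite (le_trans (ler_wpM2r _ (fg x)))// lerDl exprn_ge0 ?ltW.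
Qed.

(** This allows a contractive multiple of g to be traded for one of f. *)
Lemma C0_damp_mul f : C0_mul (C0_damp f) g = C0_mul (C0_damp g) f.
Proof.
apply: C0_ext => x; rewrite !C0_mulE !C0_dampE mulrAC [RHS]mulrAC.
by congr (_ / _); rewrite mulrAC [RHS]mulrAC; congr (_ * _); exact: mulrC.
Qed.

(** The error is f eta^2 / (|g|^2 + eta^2), and |g| eta <= |g|^2 + eta^2 since
    the smaller of |g| and eta is at most the larger one. *)
Lemma C0_damp_near f : (forall x, `|f x : K| <= `|g x : K|) ->
  `|f - C0_mul (C0_damp g) f| <= eta.
Proof.
move=> fg; apply: C0_norm_le => [|x]; first exact: ltW.
rewrite !C0_simpl C0_dampE.
have -> : (f x : K) - g x * scalar_conj (g x) / den x * f x
    = f x * eta ^+ 2 / den x.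
  rewrite [g x * _]mulrC scalar_conjM [X in _ - X]mulrC.
  apply: (mulIf (lt0r_neq0 (den_gt0 x))).
  rewrite mulrBl -!mulrA mulVf ?gt_eqF// !mulr1 -mulrBr /den.
  by rewrite [_ + eta ^+ 2]addrC addrK.
rewrite 2!normrM normfV (ger0_norm (ltW (den_gt0 x))) ler_pdivrMr//.
rewrite (ger0_norm (exprn_ge0 2 (ltW eta0))) expr2 mulrA [leRHS]mulrC.
apply: ler_wpM2r; first exact: ltW.
have h : `|f x : K| * eta <= `|g x : K| * eta by rewrite ler_wpM2r// ltW.
apply: le_trans h _.
rewrite /den.
have [xe|ex] : `|g x : K| <= eta \/ eta <= `|g x : K|.
  by apply/orP; apply: real_leVge; rewrite ?normr_real// gtr0_real.
- apply: (@le_trans _ _ (eta ^+ 2)); last by rewrite lerDr exprn_ge0.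
  by rewrite expr2 ler_wpM2r// ltW.
- apply: (@le_trans _ _ (`|g x : K| ^+ 2)).
    by rewrite [leRHS]expr2 ler_wpM2l.
  by rewrite lerDl exprn_ge0// ltW.
Qed.

End damp.

End C0_theory.

Section C0_order.
Variables (R : realType) (k : scalar_kind) (Omega : topologicalType).
Local Notation K := (scalars R k).
Local Notation C0 := (C0 R k Omega).
Implicit Types (f g h : C0) (x : Omega) (a : K).

Definition C0_real : set C0 := [set f | forall x, (f x : K) \is Num.real].

Lemma C0_re_real f : C0_real (C0_re f).
Proof. by move=> x; exact: scalar_re_real. Qed.

Lemma C0_im_real f : C0_real (C0_im f).
Proof. by move=> x; exact: scalar_im_real. Qed.

Lemma C0_abs_pos f : C0_pos (C0_abs f).
Proof. by move=> x; exact: normr_ge0. Qed.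

Lemma C0_posD f g : C0_pos f -> C0_pos g -> C0_pos (f + g).
Proof. by move=> f0 g0 x; rewrite C0_addE addr_ge0. Qed.

Lemma C0_posZ a f : 0 <= a -> C0_pos f -> C0_pos (a *: f).
Proof. by move=> a0 f0 x; rewrite C0_scaleE mulr_ge0. Qed.

Lemma C0_mul_pos f g : C0_pos f -> C0_pos g -> C0_pos (C0_mul f g).
Proof. by move=> f0 g0 x; rewrite C0_mulE mulr_ge0. Qed.

Lemma C0_real_absD f : C0_real f -> C0_pos (C0_abs f + f).
Proof.
move=> fr x; rewrite !C0_simpl -[X in _ + X]opprK subr_ge0 -normrN.
by apply: real_ler_norm; rewrite realN; exact: fr.
Qed.

Lemma C0_real_absB f : C0_real f -> C0_pos (C0_abs f - f).
Proof.
by move=> fr x; rewrite !C0_simpl subr_ge0; exact: real_ler_norm (fr x).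
Qed.

Lemma C0_abs_id f : C0_pos f -> C0_abs f = f.
Proof. by move=> f0; apply: C0_ext => x; exact: ger0_norm (f0 x). Qed.

Lemma C0_abs_norm f : `|C0_abs f| = `|f|.
Proof.
apply/eqP; rewrite eq_le; apply/andP; split; apply: C0_norm_le => // x.
  by rewrite C0_absE normr_id; exact: C0_norm_ge.
by have := C0_norm_ge (C0_abs f) x; rewrite C0_absE normr_id.
Qed.

End C0_order.

(** * Positive functionals and their norms *)

Section positive_functional.
Variables (R : realType) (k : scalar_kind) (Omega : topologicalType).
Local Notation K := (scalars R k).
Local Notation C0 := (C0 R k Omega).
Variable L : {linear C0 -> K^o}.
Hypothesis L_pos : forall f, C0_pos f -> 0 <= (L f : K).
Implicit Types (f g h : C0).

Lemma pos_functional_real f : C0_real f -> (L f : K) \is Num.real.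
Proof.
move=> fr; rewrite -[f](subKr (C0_abs f)) linearB.
by apply: rpredB; apply: ger0_real; apply: L_pos;
  [exact: C0_abs_pos|exact: C0_real_absB].
Qed.

(** Rotate f by a scalar c of modulus 1 so that L (c f) = |L f|.  As L is real
    on real functions, L (c f) is then the value of L at the real part of c f,
    and that real part is dominated by |f|. *)
Lemma pos_functional_abs f : `|L f : K| <= (L (C0_abs f) : K).
Proof.
have [->|a0] := eqVneq (L f : K) 0.
  by rewrite normr0 L_pos//; exact: C0_abs_pos.
pose c : K := scalar_conj (L f : K) / `|L f : K|.
have nz : `|L f : K| != 0 by rewrite normr_eq0.
have c1 : `|c| = 1.
  by rewrite normrM norm_scalar_conj normfV normr_id mulfV.
have Lcf : (L (c *: f) : K) = `|L f : K|.
  rewrite linearZ; change (c * (L f : K) = `|L f : K|).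
  by rewrite mulrAC scalar_conjM expr2 mulfK.
have Lre : `|L f : K| = L (C0_re (c *: f)).
  have nr : `|L f : K| \is Num.real by rewrite normr_real.
  rewrite -(real_scalar_re nr) -Lcf -{1}[c *: f]C0_reIm linearD linearZ.
  rewrite scalar_reD [X in _ + X]scalar_reM scalar_re_i mul0r.
  rewrite (real_scalar_im (pos_functional_real (C0_im_real _))).
  rewrite mulr0 subr0 addr0.
  by rewrite real_scalar_re//; apply: pos_functional_real; exact: C0_re_real.
rewrite Lre -subr_ge0 -linearB; apply: L_pos => x.
rewrite !C0_simpl subr_ge0.
apply: le_trans (real_ler_norm (scalar_re_real _)) _.
apply: le_trans (norm_scalar_re _) _.
by rewrite normrM c1 mul1r.
Qed.

End positive_functional.

Section dual_theory.
Variables (R : realType) (k : scalar_kind) (V : normedModType (scalars R k)).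
Local Notation K := (scalars R k).

HB.instance Definition _ (mu : dual V) :=
  GRing.isLinear.Build K V K^o *:%R (dual_fun mu) (dual_linear mu).

Lemma dual_norm_le (mu : dual V) (M : K) :
  0 <= M -> (forall v, `|v| <= 1 -> `|mu v : K| <= M) -> `|mu| <= M.
Proof. by move=> M0 h; apply: norm_sup_le. Qed.

Lemma dual_norm_ge (mu : dual V) v : `|mu v : K| <= `|mu| * `|v|.
Proof.
have [->|v0] := eqVneq v 0; first by rewrite linear0 !normr0 mulr0.
have nv : 0 < `|v| by rewrite normr_gt0.
rewrite -ler_pdivrMr//.
have -> : `|mu v : K| / `|v| = `|mu (`|v|^-1 *: v) : K|.
  by rewrite linearZ normrM normfV normr_id mulrC.
apply: norm_sup_ge; first exact: dual_bounded.
by rewrite /= normrZ normfV normr_id mulVf// gt_eqF.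
Qed.

End dual_theory.

Section C0_dual_theory.
Variables (R : realType) (k : scalar_kind) (Omega : topologicalType).
Local Notation K := (scalars R k).
Local Notation C0 := (C0 R k Omega).
Implicit Types (mu nu : dual C0) (f g h : C0).

Lemma dual_pos_abs mu f : dual_pos mu -> `|mu f : K| <= (mu (C0_abs f) : K).
Proof. by move=> mu0; exact: pos_functional_abs. Qed.

Lemma dual_posD mu nu : dual_pos mu -> dual_pos nu -> dual_pos (mu + nu).
Proof. by move=> mu0 nu0 f f0; apply: addr_ge0; [exact: mu0|exact: nu0]. Qed.

Lemma dual_pos_le mu f g : dual_pos mu -> C0_pos (g - f) ->
  (mu f : K) <= mu g.
Proof. by move=> mu0 fg; rewrite -subr_ge0 -linearB; exact: mu0. Qed.

(** If g and h nearly attain the norms of mu and nu, a common bound of |g| and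
    |h| in the unit ball nearly attains both at once. *)
Lemma dual_pos_normD mu nu : dual_pos mu -> dual_pos nu ->
  `|mu + nu| = `|mu| + `|nu|.
Proof.
move=> mu0 nu0; apply/eqP; rewrite eq_le ler_normD /=.
have key g h : `|g| <= 1 -> `|h| <= 1 ->
    `|mu g : K| + `|nu h : K| <= `|mu + nu|.
  move=> g1 h1.
  have g1x x : `|g x : K| <= 1 := le_trans (C0_norm_ge g x) g1.
  have h1x x : `|h x : K| <= 1 := le_trans (C0_norm_ge h x) h1.
  (* 1 - (1 - |g|) (1 - |h|): it dominates |g| and |h| and stays below 1, like
     their maximum, but needs only ring operations *)
  pose j := C0_abs g + C0_abs h - C0_mul (C0_abs g) (C0_abs h).
  have gj : C0_pos (j - C0_abs g).
    move=> x; rewrite !C0_simpl.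
    have -> : `|g x : K| + `|h x : K| - `|g x : K| * `|h x : K| - `|g x : K|
        = (1 - `|g x : K|) * `|h x : K|.
      by rewrite mulrBl mul1r addrAC [_ + `|h x : K|]addrC addrK.
    by rewrite mulr_ge0// subr_ge0.
  have hj : C0_pos (j - C0_abs h).
    move=> x; rewrite !C0_simpl.
    have -> : `|g x : K| + `|h x : K| - `|g x : K| * `|h x : K| - `|h x : K|
        = `|g x : K| * (1 - `|h x : K|).
      by rewrite mulrBr mulr1 addrAC addrK.
    by rewrite mulr_ge0// subr_ge0.
  have j1 : `|j| <= 1.
    apply: C0_norm_le => // x; rewrite !C0_simpl.
    have -> : `|g x : K| + `|h x : K| - `|g x : K| * `|h x : K|
        = 1 - (1 - `|g x : K|) * (1 - `|h x : K|).
      by move: `|g x : K| `|h x : K| => a b; ring.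
    have p0 : 0 <= (1 - `|g x : K|) * (1 - `|h x : K|).
      by rewrite mulr_ge0// subr_ge0.
    have p1 : (1 - `|g x : K|) * (1 - `|h x : K|) <= 1.
      by rewrite mulr_ile1// ?subr_ge0// gerBl.
    by rewrite ger0_norm ?subr_ge0// gerBl.
  have lej : `|mu g : K| + `|nu h : K| <= ((mu + nu) j : K).
    apply: lerD.
      exact: le_trans (dual_pos_abs g mu0) (dual_pos_le mu0 gj).
    exact: le_trans (dual_pos_abs h nu0) (dual_pos_le nu0 hj).
  apply: le_trans lej _.
  apply: le_trans (real_ler_norm _) _.
    apply: pos_functional_real; first exact: dual_posD.
    by move=> x; rewrite !C0_simpl rpredB ?rpredD ?rpredM ?normr_real.
  by rewrite (le_trans (dual_norm_ge _ _))// ler_piMr.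
have bound g : `|g| <= 1 -> `|nu| <= `|mu + nu| - `|mu g : K|.
  move=> g1; apply: dual_norm_le => [|h h1].
    have := key g 0 g1; rewrite normr0 linear0 normr0 addr0 subr_ge0.
    exact.
  by rewrite lerBrDl; exact: key.
rewrite -lerBrDr; apply: dual_norm_le => [|g g1].
  by have := bound 0; rewrite normr0 linear0 normr0 subr0 subr_ge0; exact.
by rewrite lerBrDr -lerBrDl; exact: bound.
Qed.

(** On the unit ball |mu (f g)| <= mu (f |g|) <= mu (f).  This bound is
    approached by mu (f w) for w in the unit ball such that w f is close to
    f. *)
Lemma dual_pos_norm_actd mu f : dual_pos mu -> C0_pos f ->
  `|C0_actd f mu| = mu f.
Proof.
move=> mu0 f0; apply/eqP; rewrite eq_le; apply/andP; split.
  apply: dual_norm_le => [|g g1]; first exact: mu0.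
  apply: le_trans (dual_pos_abs _ mu0) _.
  apply: dual_pos_le => // x; rewrite !C0_simpl subr_ge0 normrM.
  rewrite (ger0_norm (f0 x)); apply: ler_piMr; first exact: f0.
  exact: le_trans (C0_norm_ge g x) g1.
apply: (@ler_add_eps_mul _ _ _ _ `|mu|) => // e e0.
pose w := C0_damp f e0 f.
have -> : (mu f : K) = mu (C0_mul w f) + mu (f - C0_mul w f).
  by rewrite linearB addrC subrK.
apply: le_trans (real_ler_norm _) _.
  by rewrite -[X in X \is _]linearD addrC subrK ger0_real// mu0.
apply: le_trans (ler_normD _ _) _; apply: lerD.
  have -> : C0_mul w f = C0_mul f w.
    by apply: C0_ext => x; exact: mulrC.
  apply: le_trans (dual_norm_ge (C0_actd f mu) w) _.
  by rewrite ler_piMr//; apply: C0_damp_le1.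
apply: le_trans (dual_norm_ge _ _) _.
by rewrite mulrC ler_wpM2r//; apply: C0_damp_near.
Qed.

Lemma dual_pos_ext mu nu : (forall f, C0_pos f -> mu f = nu f) -> mu = nu.
Proof.
move=> munu; apply: val_inj; apply/funext => f.
have real_eq g : C0_real g -> mu g = nu g.
  move=> gr.
  have split (xi : dual C0) : xi g = xi (C0_abs g + g) - xi (C0_abs g).
    by rewrite -linearB addrC addKr.
  by rewrite !split !munu//; [exact: C0_abs_pos|exact: C0_real_absD].
change (mu f = nu f); rewrite -[f]C0_reIm !linearD !linearZ.
by congr (_ + _ *: _); apply: real_eq; [exact: C0_re_real|exact: C0_im_real].
Qed.

End C0_dual_theory.

(** * Extension of additive functions from the cone *)

(** A positively homogeneous additive function p on the non-negative functions
    extends first to the real functions, as f |-> p g - p h for any way of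
    writing f = g - h with g and h non-negative; the choice g = |f| + f and
    h = |f| involves no case distinction.  Real and imaginary parts then give
    the extension L to all of C0.  It is positive, so |L f| <= p |f|, and the
    bound on p makes it continuous.  The hypotheses are those satisfied by
    f |-> ||f s||. *)
Section cone_extension.
Variables (R : realType) (k : scalar_kind) (Omega : topologicalType).
Local Notation K := (scalars R k).
Local Notation C0 := (C0 R k Omega).
Local Notation I := (scalar_i R k).
Variables (p : C0 -> K) (c : K).
Hypothesis c_ge0 : 0 <= c.
Hypothesis pD : forall f g, C0_pos f -> C0_pos g -> p (f + g) = p f + p g.
Hypothesis pZ : forall (a : K) (f : C0), 0 <= a -> p (a *: f) = a * p f.
Hypothesis p_ge0 : forall f, C0_pos f -> 0 <= p f.
Hypothesis p_le : forall f, C0_pos f -> p f <= c * `|f|.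
Implicit Types (f g h : C0) (a : K).

Let q f := p (C0_abs f + f) - p (C0_abs f).

Let q_sub f g h : f = g - h -> C0_pos g -> C0_pos h -> q f = p g - p h.
Proof.
move=> fgh g0 h0.
have fr : C0_real f.
  move=> x; rewrite fgh; apply: rpredB; apply: ger0_real; first exact: g0.
  exact: h0.
have fa := C0_abs_pos f; have faf := C0_real_absD fr.
have e : p (C0_abs f + f) + p h = p (C0_abs f) + p g.
  by rewrite -!pD// -addrA fgh subrK.
by apply/eqP; rewrite /q subr_eq addrAC [p g + _]addrC -e addrK.
Qed.

Let q_pos f : C0_pos f -> q f = p f.
Proof.
move=> f0; rewrite /q pD//; last exact: C0_abs_pos.
by rewrite addrC addKr.
Qed.

Let qD f g : C0_real f -> C0_real g -> q (f + g) = q f + q g.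
Proof.
move=> fr gr.
have [fa ga] := (C0_abs_pos f, C0_abs_pos g).
have [fp gp] := (C0_real_absD fr, C0_real_absD gr).
rewrite (@q_sub _ (C0_abs f + f + (C0_abs g + g)) (C0_abs f + C0_abs g)).
- by rewrite (pD fp gp) (pD fa ga) /q opprD addrACA.
- by rewrite addrACA [RHS]addrC addKr.
- exact: C0_posD.
- exact: C0_posD.
Qed.

Let qZ a f : a \is Num.real -> C0_real f -> q (a *: f) = a * q f.
Proof.
move=> ar fr.
have [fa fp] := (C0_abs_pos f, C0_real_absD fr).
have [a0|a0] := real_leP (real0 K) ar.
  rewrite (@q_sub _ (a *: (C0_abs f + f)) (a *: C0_abs f)).
  - by rewrite !pZ// mulrBr.
  - by rewrite -scalerBr [_ + f]addrC addrK.
  - exact: C0_posZ.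
  - exact: C0_posZ.
have na0 : 0 <= - a by rewrite oppr_ge0 ltW.
rewrite (@q_sub _ (- a *: C0_abs f) (- a *: (C0_abs f + f))).
- by rewrite !pZ// !mulNr opprK mulrBr addrC.
- by rewrite -scalerBr opprD addNKr scalerN scaleNr opprK.
- exact: C0_posZ.
- exact: C0_posZ.
Qed.

Let L f : K^o := q (C0_re f) + I * q (C0_im f).

Let L_linear : linear L.
Proof.
move=> a f g.
have ar := scalar_re_real a; have ai := scalar_im_real a.
have nai : - scalar_im a \is Num.real by rewrite realN.
have [fr fi] := (C0_re_real f, C0_im_real f).
have [gr gi] := (C0_re_real g, C0_im_real g).
have realZ b h : b \is Num.real -> C0_real h -> C0_real (b *: h).
  by move=> br hr x; rewrite C0_scaleE rpredM.
have realD h h' : C0_real h -> C0_real h' -> C0_real (h + h').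
  by move=> hr hr' x; rewrite C0_addE rpredD.
have -> : L (a *: f + g) =
    q (scalar_re a *: C0_re f + - scalar_im a *: C0_im f + C0_re g)
    + I * q (scalar_re a *: C0_im f + scalar_im a *: C0_re f + C0_im g).
  congr (q _ + _ * q _); apply: C0_ext => x; rewrite !C0_simpl.
    by rewrite scalar_reD scalar_reM mulNr.
  by rewrite scalar_imD scalar_imM.
rewrite !qD ?qZ//;
  do ?[exact: realD|exact: realZ|by apply: realD; exact: realZ].
change (scalar_re a * q (C0_re f) + - scalar_im a * q (C0_im f) + q (C0_re g)
    + I * (scalar_re a * q (C0_im f) + scalar_im a * q (C0_re f) + q (C0_im g))
  = a * L f + L g).
rewrite -[in RHS](scalar_rect a) -scalar_iiM /L.
move: (q _) (q _) (q _) (q _) => q1 q2 q3 q4.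
move: (scalar_re a) (scalar_im a) (scalar_i R k) => r i j.
ring.
Qed.

Let L_pos f : C0_pos f -> L f = p f.
Proof.
move=> f0; have fr x := ger0_real (f0 x).
rewrite /L; have -> : C0_re f = f.
  by apply: C0_ext => x; rewrite C0_reE real_scalar_re.
have -> : C0_im f = 0.
  by apply: C0_ext => x; rewrite C0_imE real_scalar_im.
have -> : q 0 = 0 by rewrite -(scaler0 _ 0) qZ ?mul0r// => x; exact: real0.
by rewrite mulr0 addr0 q_pos.
Qed.

Lemma cone_extension : exists mu : dual C0, forall f, C0_pos f -> mu f = p f.
Proof.
pose LL := GRing.isLinear.Build K C0 K^o *:%R L L_linear.
pose l : {linear C0 -> K^o} := HB.pack L LL.
have l_ge0 f : C0_pos f -> 0 <= (l f : K).
  by move=> f0; change (0 <= (L f : K)); rewrite L_pos// p_ge0.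
have lc : continuous l.
  apply: (@bounded_linear_continuous _ _ _ l); apply/bounded_funP => r.
  exists (c * `|r|) => f fr.
  apply: le_trans (pos_functional_abs l_ge0 f) _.
  change ((L (C0_abs f) : K) <= c * `|r|).
  have fa := C0_abs_pos f; rewrite (L_pos fa).
  apply: le_trans (p_le fa) _; rewrite C0_abs_norm ler_wpM2l//.
  by rewrite (le_trans fr)// real_ler_norm// ger0_real// (le_trans _ fr).
have Ld : (L : C0 -> K^o) \in @is_dual R k C0.
  by apply/asboolP; split; [exact: L_linear|exact: lc].
by exists (MkDual Ld); exact: L_pos.
Qed.

End cone_extension.

(** * Banach modules *)

Lemma closure_norm_lt (K : numFieldType) (V : normedModType K) (A : set V) v e :
  closure A v -> 0 < e -> exists2 u, A u & `|v - u| < e.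
Proof.
move=> Av e0; have [u [Au]] := Av _ (nbhsx_ballx v e e0).
by rewrite -ball_normE /= => vu; exists u.
Qed.

Section module_theory.
Variables (R : realType) (k : scalar_kind) (Omega : topologicalType).
Variable (Gamma : completeNormedModType (scalars R k)).
Local Notation K := (scalars R k).
Local Notation C0 := (C0 R k Omega).
Variable act : C0 -> Gamma -> Gamma.
Hypothesis bm : banach_module act.
Implicit Types (f g h : C0) (s : Gamma).

Let actl s : {linear C0 -> Gamma} :=
  HB.pack (act^~ s) (GRing.isLinear.Build K C0 Gamma *:%R _ (act_linearl bm s)).

Let actr f : {linear Gamma -> Gamma} :=
  HB.pack (act f)
    (GRing.isLinear.Build K Gamma Gamma *:%R _ (act_linearr bm f)).

Lemma actDl f g s : act (f + g) s = act f s + act g s.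
Proof. exact: (linearD (actl s)). Qed.

Lemma actBl f g s : act (f - g) s = act f s - act g s.
Proof. exact: (linearB (actl s)). Qed.

Lemma actZl (a : K) f s : act (a *: f) s = a *: act f s.
Proof. exact: (linearZ_LR (actl s)). Qed.

Lemma actDr f s t : act f (s + t) = act f s + act f t.
Proof. exact: (linearD (actr f)). Qed.

Lemma actBr f s t : act f (s - t) = act f s - act f t.
Proof. exact: (linearB (actr f)). Qed.

Lemma actZr (a : K) f s : act f (a *: s) = a *: act f s.
Proof. exact: (linearZ_LR (actr f)). Qed.

Lemma act_sumr f n (F : 'I_n -> Gamma) :
  act f (\sum_i F i) = \sum_i act f (F i).
Proof. exact: (linear_sum (actr f)). Qed.

(** Up to an error e, f is a contractive multiple of g. *)
Lemma act_norm_mono f g s : (forall x, `|f x : K| <= `|g x : K|) ->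
  `|act f s| <= `|act g s|.
Proof.
move=> fg; apply: (@ler_add_eps_mul _ _ _ _ `|s|) => // e e0.
pose w := C0_mul (C0_damp g e0 g) f.
rewrite -[f](subrK w) actDl [leRHS]addrC.
apply: le_trans (ler_normD _ _) _; apply: lerD.
  apply: le_trans (act_norm bm _ _) _.
  by rewrite ler_wpM2r//; exact: C0_damp_near.
rewrite /w -C0_damp_mul actM//.
apply: le_trans (act_norm bm _ _) _.
by rewrite ler_piMl//; exact: C0_damp_le1.
Qed.

Lemma act_norm_abs f s : `|act (C0_abs f) s| = `|act f s|.
Proof.
by apply/eqP; rewrite eq_le !act_norm_mono// => x; rewrite C0_absE normr_id.
Qed.

(** By non-degeneracy s is close to a finite combination of vectors f_i v_i; the
    approximate unit belonging to the sum of the |f_i| serves all the f_i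
    together. *)
Lemma act_approx_unit s (e : K) : 0 < e ->
  exists2 u : C0, `|u| <= 1 & `|s - act u s| <= e.
Proof.
move=> e0.
have e30 : 0 < e / 3 by rewrite divr_gt0.
have : closure (lin [set act f s | f in [set: C0] & s in [set: Gamma]]) s.
  by rewrite (act_nondegenerate bm).
case/closure_norm_lt/(_ e30) => t [n [a [v [vA ->]]]] st.
have {vA}/choice[F vF] : forall i, exists z : C0 * Gamma, v i = act z.1 z.2.
  by move=> i; have [f _ [z _ <-]] := vA i; exists (f, z).
pose h : C0 := \sum_i C0_abs (F i).1.
have Fh i x : `|(F i).1 x : K| <= `|h x : K|.
  have abs_ge0 j : 0 <= (C0_abs (F j).1 x : K) by exact: C0_abs_pos.
  rewrite /h C0_sumE [leRHS]ger0_norm; last by apply: sumr_ge0 => j _.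
  by rewrite (bigD1 i)//= lerDl; apply: sumr_ge0 => j _.
pose c := \sum_i `|a i| * `|(F i).2|.
have c0 : 0 <= c by apply: sumr_ge0 => i _; exact: mulr_ge0.
have c1 : 0 < c + 1 by rewrite ltr_wpDl.
have d0 : 0 < e / 3 / (c + 1) by rewrite divr_gt0.
pose u := C0_damp h d0 h; have u1 : `|u| <= 1 by exact: C0_damp_le1.
exists u => //.
set y := \sum_i a i *: v i in st *.
have -> : s - act u s = (s - y) + (y - act u y) - act u (s - y).
  by rewrite actBr opprB !subrKA.
have -> : e = e / 3 + e / 3 + e / 3 by field.
apply: le_trans (ler_normB _ _) _; apply: lerD; last first.
  apply: le_trans (act_norm bm _ _) _.
  by rewrite (le_trans _ (ltW st))// ler_piMl.
apply: le_trans (ler_normD _ _) _; apply: lerD; first exact: ltW.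
have -> : y - act u y
    = \sum_i a i *: act ((F i).1 - C0_mul u (F i).1) (F i).2.
  rewrite /y act_sumr -sumrB; apply: eq_bigr => i _.
  by rewrite actZr -scalerBr actBl actM// -vF.
apply: le_trans (ler_norm_sum _ _ _) _.
apply: (@le_trans _ _ (c * (e / 3 / (c + 1)))).
  rewrite /c mulr_suml; apply: ler_sum => i _.
  rewrite normrZ -mulrA ler_wpM2l// mulrC.
  apply: le_trans (act_norm bm _ _) _.
  by rewrite ler_wpM2r//; exact: C0_damp_near.
rewrite mulrCA; apply: ler_piMr; first exact: ltW.
by rewrite ler_pdivrMr// mul1r lerDl.
Qed.

(** The dual-valued norm turns f s into f . |s|, whose norm is |s|(f). *)
Lemma dual_valued_norm_actE (N : Gamma -> dual C0) : dual_valued_norm act N ->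
  forall s f, C0_pos f -> N s f = `|act f s|.
Proof.
move=> nN s f f0; rewrite -(dvn_norm nN) (dvn_act nN) (C0_abs_id f0).
by rewrite dual_pos_norm_actd//; exact: (dvn_pos nN).
Qed.

(** On the vectors f s with f >= 0 additivity is that of the dual norm; elements
    of the closed cone are approximated by these. *)
Lemma dual_valued_norm_AL (N : Gamma -> dual C0) :
  dual_valued_norm act N -> AL_module act.
Proof.
move=> nN s u v us vs.
apply/eqP; rewrite eq_le ler_normD /=.
(* u and v are each replaced twice by nearby vectors, at a cost of e each *)
apply: (@ler_add_eps_mul _ _ _ _ 4) => // e e0.
have [_ [f f0 <-] uf] := closure_norm_lt us e0.
have [_ [g g0 <-] vg] := closure_norm_lt vs e0.
have additive : `|act f s| + `|act g s| = `|act f s + act g s|.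
  rewrite -actDl -!(dvn_norm nN) !(dvn_act nN).
  rewrite (C0_abs_id f0) (C0_abs_id g0) (C0_abs_id (C0_posD f0 g0)).
  have pN := dvn_pos nN s.
  by rewrite !dual_pos_norm_actd// ?linearD//; exact: C0_posD.
have ule : `|u| <= `|act f s| + e.
  rewrite -[u](subrK (act f s)) [leRHS]addrC.
  rewrite (le_trans (ler_normD _ _))// lerD2r.
  exact: ltW.
have vle : `|v| <= `|act g s| + e.
  rewrite -[v](subrK (act g s)) [leRHS]addrC.
  rewrite (le_trans (ler_normD _ _))// lerD2r.
  exact: ltW.
have sle : `|act f s + act g s| <= `|u + v| + (e + e).
  have -> : act f s + act g s = (u + v) - ((u - act f s) + (v - act g s)).
    by rewrite addrACA -opprD opprB [RHS]addrC subrK.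
  apply: le_trans (ler_normB _ _) _; rewrite lerD2l.
  by apply: le_trans (ler_normD _ _) _; rewrite lerD// ltW.
apply: le_trans (lerD ule vle) _.
rewrite addrACA additive (le_trans (lerD sle (lexx _)))//.
rewrite -addrA lerD2l.
suff -> : e * 4 = e + e + (e + e) by [].
by ring.
Qed.

Lemma AL_dual_valued_norm : AL_module act ->
  exists N : Gamma -> dual C0, dual_valued_norm act N.
Proof.
move=> AL.
have /choice[N NE] : forall s, exists mu : dual C0,
    forall f, C0_pos f -> mu f = `|act f s|.
  move=> s; apply: (@cone_extension _ _ _ (fun f => `|act f s|) `|s|) => //.
  - move=> f g f0 g0; rewrite actDl; apply: (AL s); apply: subset_closure.
      by exists f.
    by exists g.
  - by move=> a f a0; rewrite actZl normrZ ger0_norm.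
  - by move=> f _; rewrite mulrC; exact: act_norm.
have Npos s : dual_pos (N s) by move=> f f0; rewrite NE.
exists N; split=> // [s|f s|s t f f0].
- apply/eqP; rewrite eq_le; apply/andP; split.
    apply: dual_norm_le => // f f1.
    apply: le_trans (dual_pos_abs f (Npos s)) _.
    rewrite NE; last exact: C0_abs_pos.
    by rewrite act_norm_abs (le_trans (act_norm bm _ _))// ler_piMl.
  apply: (@ler_add_eps_mul _ _ _ _ 1) => // e e0; rewrite mulr1.
  (* ||s|| is nearly ||u s|| = || |u| s|| = |s|(|u|), and |u| is in the unit
     ball *)
  have [u u1 us] := act_approx_unit s e0.
  rewrite -{1}[s](subrK (act u s)) [leRHS]addrC.
  apply: le_trans (ler_normD _ _) _; apply: lerD => //.
  rewrite -act_norm_abs -NE; last exact: C0_abs_pos.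
  rewrite (le_trans (real_ler_norm _))//.
    by apply: ger0_real; apply: Npos; exact: C0_abs_pos.
  by rewrite (le_trans (dual_norm_ge _ _))// C0_abs_norm ler_piMr.
- apply: dual_pos_ext => g g0.
  have fa := C0_abs_pos f.
  rewrite NE// -actM//.
  change (`|act (C0_mul g f) s| = N s (C0_mul (C0_abs f) g)).
  rewrite NE; last exact: C0_mul_pos.
  rewrite -act_norm_abs; congr (`|act _ s|); apply: C0_ext => x.
  by rewrite !C0_simpl normrM (ger0_norm (g0 x)); exact: mulrC.
- change (0 <= (N s f + N t f - N (s + t) f : K)).
  by rewrite !NE// subr_ge0 actDr ler_normD.
Qed.

End module_theory.

(** * The equivalence *)

Theorem proposition5p9 (R : realType) (k : scalar_kind)
    (Omega : topologicalType) (Gamma : completeNormedModType (scalars R k))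
    (act : C0 R k Omega -> Gamma -> Gamma) :
  hausdorff_space Omega -> locally_compact [set: Omega] ->
  banach_module act ->
  (AL_module act <->
    exists N : Gamma -> dual (C0 R k Omega), dual_valued_norm act N) /\
  (AL_module act ->
    (exists! N : Gamma -> dual (C0 R k Omega), dual_valued_norm act N) /\
    (forall N : Gamma -> dual (C0 R k Omega), dual_valued_norm act N ->
       forall (s : Gamma) (f : C0 R k Omega),
         C0_pos f -> N s f = `|act f s|)).
Proof.
move=> _ _ bm; split.
  split=> [|[N nN]]; first exact: AL_dual_valued_norm.
  exact: dual_valued_norm_AL nN.
move=> AL; split; last by move=> N nN s f; exact: dual_valued_norm_actE.
have [N nN] := AL_dual_valued_norm bm AL; exists N; split=> // M nM.
apply/funext => s; apply: dual_pos_ext => f f0.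
by rewrite (dual_valued_norm_actE nN)// (dual_valued_norm_actE nM).
Qed.
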